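(* Let $\theta\in(0,\pi/2)$. There exists $c>0$ such that \[ \mathfrak{q}_\theta[u]-\|u\|^2_{L^2(\mathsf{Gui}(\theta))}\ \ge\ c\int_{\mathsf{Gui}(\theta)}\frac{(r\cos\theta-z\sin\theta)^3}{1+\frac{r^2}{\sin^2\theta}\ln^2\!\Big(\frac{r}{\cos\theta}\,\frac{2}{r\cos\theta-z\sin\theta}\Big)}\,|u|^2\,dr\,dz \] holds for any $u\in\mathcal{C}^\infty_0(\mathsf{Gui}(\theta))$.
   Context: For $\theta\in(0,\pi/2)$, \[ \mathsf{Gui}(\theta)=\Big\{(r,z)\in(0,+\infty)\times\mathbb{R} : -\tfrac{\pi}{\sin\theta}<z,\ \max(0,z\tan\theta)<r<z\tan\theta+\tfrac{\pi}{\cos\theta}\Big\}. \] The critical flux is $\omega_{\rm cr}=\omega_{\rm cr}(\theta)=\frac{\cos\theta}{2}$, and for $u\in\mathcal{C}^\infty_0(\mathsf{Gui}(\theta))$ \[ \mathfrak{q}_\theta[u]=\int_{\mathsf{Gui}(\theta)}\Big(|\partial_r u|^2+|\partial_z u|^2+\frac{\omega_{\rm cr}^2-1/4}{r^2}|u|^2\Big)\,dr\,dz . \] Here $L^2(\mathsf{Gui}(\theta))$ is taken with respect to the Lebesgue measure $dr\,dz$. *)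

(* Defs.v *)
From HB Require Import structures.
From mathcomp Require Import all_boot all_order all_algebra.
From mathcomp Require Import all_classical all_reals all_analysis.
From mathcomp Require Import complex.

Set Implicit Arguments.
Unset Strict Implicit.
Unset Printing Implicit Defensive.

Import Order.TTheory GRing.Theory Num.Theory.
Import numFieldNormedType.Exports.

Local Open Scope classical_set_scope.
Local Open Scope ring_scope.

(* A point p : R * R has coordinates (r, z) = (p.1, p.2). *)

Definition d_r (R : realType) (f : R * R -> R) (p : R * R) : R :=
  'D_(1 : R, 0 : R) f p.

Definition d_z (R : realType) (f : R * R -> R) (p : R * R) : R :=
  'D_(0 : R, 1 : R) f p.

Fixpoint Ck (R : realType) (k : nat) (f : R * R -> R) : Prop :=
  continuous f /\
  if k is k'.+1 then
    [/\ forall p, derivable f p (1 : R, 0 : R),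
        forall p, derivable f p (0 : R, 1 : R),
        Ck k' (d_r f)
      & Ck k' (d_z f)]
  else True.

Definition smooth (R : realType) (f : R * R -> R) : Prop :=
  forall k, Ck k f.

Definition re_fun (R : realType) (u : R * R -> R[i]) (p : R * R) : R :=
  complex.Re (u p).

Definition im_fun (R : realType) (u : R * R -> R[i]) (p : R * R) : R :=
  complex.Im (u p).

Definition cd_r (R : realType) (u : R * R -> R[i]) (p : R * R) : R[i] :=
  Complex (d_r (re_fun u) p) (d_r (im_fun u) p).

Definition cd_z (R : realType) (u : R * R -> R[i]) (p : R * R) : R[i] :=
  Complex (d_z (re_fun u) p) (d_z (im_fun u) p).

(* Complex-valued test functions on an open set D of the plane, each
   identified with its extension by zero outside D. *)
Definition test_function (R : realType) (D : set (R * R))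
    (u : R * R -> R[i]) : Prop :=
  let supp := closure [set p | u p != 0] in
  [/\ smooth (re_fun u), smooth (im_fun u), compact supp & supp `<=` D].

Definition Gui (R : realType) (theta : R) : set (R * R) :=
  [set p | [/\ 0 < p.1,
               - (pi / sin theta) < p.2,
               Num.max 0 (p.2 * tan theta) < p.1
             & p.1 < p.2 * tan theta + pi / cos theta]].

Definition omega_cr (R : realType) (theta : R) : R := cos theta / 2.

Definition lebesgue2 (R : realType) :=
  (@lebesgue_measure R \x @lebesgue_measure R)%E.

Definition q_form (R : realType) (theta : R) (u : R * R -> R[i]) : \bar R :=
  (\int[@lebesgue2 R]_(p in Gui theta)
     (Normc.normc (cd_r u p) ^+ 2 + Normc.normc (cd_z u p) ^+ 2
      + (omega_cr theta ^+ 2 - 1 / 4) / p.1 ^+ 2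
        * Normc.normc (u p) ^+ 2)%:E)%E.

Definition sqL2norm (R : realType) (D : set (R * R)) (u : R * R -> R[i]) :
    \bar R :=
  (\int[@lebesgue2 R]_(p in D) (Normc.normc (u p) ^+ 2)%:E)%E.

Definition hardy_weight (R : realType) (theta : R) (p : R * R) : R :=
  let s := p.1 * cos theta - p.2 * sin theta in
  s ^+ 3 /
  (1 + p.1 ^+ 2 / sin theta ^+ 2 * ln (p.1 / cos theta * (2 / s)) ^+ 2).

(* Main.v *)
Require Import Defs.
From mathcomp Require Import all_boot all_order all_algebra.
From mathcomp Require Import all_classical all_reals all_analysis.
From mathcomp Require Import complex.
From mathcomp Require Import ring lra.

(** In the rotated coordinates [s = r cos theta - z sin theta] and
    [t = r sin theta + z cos theta] the domain is the half-strip [0 < s < pi],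
    [0 < rho], where [rho = r / sin theta = t + a s] and [a = cot theta], and the
    potential is [- 1 / (4 rho^2)]. On each line [s] constant the one-dimensional
    Hardy inequality controls the potential; on each line [t] constant the
    Dirichlet eigenvalue of [(0, pi)] gives at least the squared L^2 norm. The
    inequality to prove improves on the sum of these two.

    If a C^1 field [F] on the domain satisfies
    [div F - |F|^2 >= 1 + 1 / (4 rho^2) + c W], where [W] is the Hardy weight,
    then integrating [|grad u + u F|^2 >= 0] for a test function [u], whose
    compact support lies in the domain, gives the claim
    ([vector_field_barrier]). No regularity of [F] at the boundary is needed, and
    the integration by parts is done along the original axes, so that the measure
    is never rotated.

    The field is explicit: with [d = max(0, - t / a)], [y = 2 rho / (a s)] and
    [m(y) = 1 + ln y + 1 / (4 y^2)],
    [[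
      F_s = - cot s - eps d^3 (pi - s) / sin^2 s,
      F_t = - 1 / (2 rho) - delta s^3 / (m(y) rho).
    ]]
    The leading terms give exactly [1 + 1 / (4 rho^2)]. For [t < 0] the line of
    constant [t] only meets the domain in [d < s < pi], a shorter interval, and the perturbation of
    [F_s] converts this into an excess of at least [eps d^3 / (2 sin^2 s)], which
    is of order [s] where [y < 1], because [d] then exceeds [s / 2]
    ([transverse_gain]). The perturbation of [F_t] brings
    [delta s^3 (1 - 1 / (2 y^2) - delta s^3) / (m(y) rho)^2]
    ([longitudinal_gain]): for [y >= 1] this dominates a positive multiple of
    [W] ([far_gain]), while for [y < 1] it costs at most a small multiple of [s]
    ([near_loss]), paid for by the transverse excess. Adding up ([gain_bound])
    yields the differential inequality. *)

Set Implicit Arguments.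
Unset Strict Implicit.
Unset Printing Implicit Defensive.

Import Order.TTheory GRing.Theory Num.Theory.
Import numFieldNormedType.Exports.

Local Open Scope classical_set_scope.
Local Open Scope ring_scope.

(** * Integration in the plane *)

Section PlaneIntegration.
Context {R : realType}.
Implicit Types (f g : R * R -> R) (D K : set (R * R)).

(** The product sigma-algebra of the plane contains the open sets: an open set
    is a countable union of boxes with rational endpoints. *)
Lemma open_measurable2 (U : set (R * R)) : open U -> measurable U.
Proof.
move=> oU.
pose box (q : rat * rat * (rat * rat)) : set (R * R) :=
  `]ratr q.1.1, ratr q.1.2[ `*` `]ratr q.2.1, ratr q.2.2[.
have -> : U = \bigcup_q (if `[< box q `<=` U >] then box q else set0).
  apply/seteqP; split=> [p Up|p [q _]]; last by case: asboolP => // qU /qU.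
  have /nbhs_ballP[e /= e0 eU] : nbhs p U by apply: open_nbhs_nbhs.
  have lo (x : R) : x - e < x by rewrite ltrBlDr ltrDl.
  have hi (x : R) : x < x + e by rewrite ltrDl.
  have [a] := rat_in_itvoo (lo p.1); rewrite in_itv/= => /andP[a1 a2].
  have [b] := rat_in_itvoo (hi p.1); rewrite in_itv/= => /andP[b1 b2].
  have [c] := rat_in_itvoo (lo p.2); rewrite in_itv/= => /andP[c1 c2].
  have [d] := rat_in_itvoo (hi p.2); rewrite in_itv/= => /andP[d1 d2].
  exists ((a, b), (c, d)) => //; case: asboolP; first by
    split; rewrite /= in_itv/= ?a2 ?b1 ?c2 ?d1.
  case=> q [/=]; rewrite !in_itv/= => /andP[q1 q2] /andP[q3 q4].
  apply: eU; split; rewrite /ball/= distrC ltr_distl; apply/andP; split; lra.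
apply: countable_bigcupT_measurable => [|q]; first exact: countableP.
by case: ifP => _; [apply: measurableX; exact: measurable_itv|exact: measurable0].
Qed.

Lemma continuous_measurable2 f : continuous f -> measurable_fun setT f.
Proof.
move=> /continuousP cf; apply: (measurability _ (measurable_realfun.RGenOpens.measurableE R)).
move=> _ [_ [a [b ->] <-]]; rewrite setTI; apply: open_measurable2.
exact/cf/interval_open.
Qed.

Lemma continuous_eq0_off_compact_integrable f K : continuous f -> compact K ->
  (forall p, ~ K p -> f p = 0) ->
  (@lebesgue2 R).-integrable setT (EFin \o f).
Proof.
move=> cf cK f0.
have [M [_ MK]] := compact_bounded cK.
have [N [_ NK]] : [bounded f x | x in K].
  have /compact_bounded[N [Nr NK]] : compact (f @` K).
    by apply: continuous_compact => //; exact: continuous_subspaceT.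
  by exists N; split => // r Nr' p Kp; apply: NK => //; exists p.
pose B : set (R * R) := `[- (`|M| + 1), `|M| + 1] `*` `[- (`|M| + 1), `|M| + 1].
have mB : measurable B by apply: measurableX; exact: measurable_itv.
have KB : K `<=` B.
  move=> p Kp; have := MK (`|M| + 1) _ p Kp.
  rewrite ltr_pwDr// ?ler_norm// => /(_ isT).
  rewrite /= /Num.norm/= ge_max => /andP[p1 p2].
  by split; rewrite /= in_itv/= -ler_norml.
have fB : f \_ B = f.
  apply/funext => p; rewrite patchE; case: ifPn => // /negP; rewrite inE => nB.
  by rewrite f0// => /KB.
have -> : EFin \o f = (EFin \o f) \_ B.
  by rewrite -{1}fB; apply/funext => p /=; rewrite !patchE; case: ifP.
apply: (@integrable_mkcond _ _ _ (@lebesgue2 R) B (EFin \o f) mB).1.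
apply: measurable_bounded_integrable => //.
- set I := `[- (`|M| + 1), `|M| + 1] in B mB KB fB *.
  have E := @product_measure1E _ _ _ _ R lebesgue_measure lebesgue_measure _ _
    (measurable_itv I) (measurable_itv I).
  rewrite [X in (X < _)%E]E.
  have L : lebesgue_measure [set` I] = ((`|M| + 1) - - (`|M| + 1))%:E.
    rewrite [LHS]lebesgue_measure_itv/= ifT// lte_fin.
    by have := normr_ge0 M; lra.
  by rewrite [X in (X * _)%E]L [X in (_ * X)%E]L -EFinM ltry.
- by apply: measurable_funTS; exact: continuous_measurable2.
- exists `|N|; split; first by rewrite num_real.
  move=> r Nr p _; have [Kp|nKp] := pselect (K p).
    by apply: NK => //; apply: le_lt_trans Nr; exact: ler_norm.
  by rewrite /= f0// normr0 (le_trans _ (ltW Nr)).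
Qed.

End PlaneIntegration.

(** * Integrals of derivatives of compactly supported functions *)

Section DivergencePlane.
Context {R : realType}.
Implicit Types (f g A dA : R * R -> R) (D K : set (R * R)).

Lemma near_eq0_off_closed g K p : closed K -> (forall q, ~ K q -> g q = 0) ->
  ~ K p -> \forall q \near p, g q = 0.
Proof.
move=> cK g0 nKp; apply: (filterS g0).
by apply: open_nbhs_nbhs; split => //; exact: closed_openC.
Qed.

(** [g] may be singular outside [D]: continuity on [D] and vanishing off a
    closed [K] contained in [D] give continuity everywhere. *)
Lemma continuous_zero_extension g D K : closed K -> K `<=` D ->
  (forall p, D p -> {for p, continuous g}) ->
  (forall p, ~ K p -> g p = 0) -> continuous g.
Proof.
move=> cK KD cg g0 p; have [Kp|nKp] := pselect (K p); first exact/cg/KD.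
have g0p := near_eq0_off_closed cK g0 nKp.
rewrite /continuous_at g0//; apply: cvg_near_cst.
exact: g0p.
Qed.

Lemma is_derive_eq0_off_closed g K p v : closed K -> (forall q, ~ K q -> g q = 0) ->
  ~ K p -> is_derive p v g 0.
Proof.
move=> cK g0 nKp.
apply: (near_eq_is_derive _ (is_derive_cst (0 : R) p v)).
by apply: filterS (near_eq0_off_closed cK g0 nKp) => q ->.
Qed.

Lemma is_derive_line1 f (x y d : R) : is_derive (x, y) (1 : R, 0 : R) f d ->
  is_derive x 1 (fun r : R => f (r, y)) d.
Proof.
have E : (fun h : R => h^-1 *: (((fun r => f (r, y)) \o shift x) (h *: 1) - f (x, y)))
       = (fun h => h^-1 *: ((f \o shift (x, y)) (h *: (1 : R, 0 : R)) - f (x, y))).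
  apply/funext => h /=; congr (_ *: (f _ - _)).
  by apply/pair_equal_spec; split => //=; rewrite scaler0 add0r.
by case=> df dfE; split; [rewrite /derivable E|rewrite /derive E].
Qed.

Lemma is_derive_line2 f (x y d : R) : is_derive (x, y) (0 : R, 1 : R) f d ->
  is_derive y 1 (fun z => f (x, z)) d.
Proof.
have E : (fun h : R => h^-1 *: (((fun z => f (x, z)) \o shift y) (h *: 1) - f (x, y)))
       = (fun h => h^-1 *: ((f \o shift (x, y)) (h *: (0 : R, 1 : R)) - f (x, y))).
  apply/funext => h /=; congr (_ *: (f _ - _)).
  by apply/pair_equal_spec; split => //=; rewrite scaler0 add0r.
by case=> df dfE; split; [rewrite /derivable E|rewrite /derive E].
Qed.

Lemma integral_derive_eq0 (F f : R -> R) (M : R) : 0 < M ->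
  (forall x : R, is_derive x 1 F (f x)) -> continuous f ->
  (forall x, M <= `|x| -> F x = 0) -> (forall x, M <= `|x| -> f x = 0) ->
  (\int[lebesgue_measure]_x (f x)%:E = 0)%E.
Proof.
move=> M0 dF cf F0 f0.
have fE : (EFin \o f) \_ `[- M, M] = EFin \o f.
  apply/funext => x; rewrite patchE; case: ifPn => // /negP; rewrite inE/= in_itv/=.
  rewrite -ler_norml => /negP; rewrite -ltNge => /ltW Mx; by rewrite /= f0.
have cF : continuous F.
  by move=> x; apply/differentiable_continuous/derivable1_diffP; case: (dF x).
rewrite -[LHS]/(\int[lebesgue_measure]_x (EFin \o f) x)%E -fE -integral_mkcond.
rewrite (@continuous_FTC2 _ f F).
- by rewrite !F0 ?subee// ?normrN ger0_norm// ltW.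
- lra.
- exact: continuous_subspaceT.
- split.
  + by move=> x _; case: (dF x).
  + exact/cvg_at_right_filter/cF.
  + exact/cvg_at_left_filter/cF.
- by move=> x _; rewrite derive1E; case: (dF x).
Qed.

Lemma compact_box K : compact K ->
  exists2 M : R, 0 < M & forall x y, K (x, y) -> `|x| < M /\ `|y| < M.
Proof.
move=> /compact_bounded[M [_ MK]]; have M0 := normr_ge0 M.
exists (`|M| + 2) => [|x y Kxy]; first by lra.
have := MK (`|M| + 1) _ (x, y) Kxy; rewrite ltr_pwDr// ?ler_norm// => /(_ isT).
rewrite /= /Num.norm/= ge_max /= => /andP[p1 p2]; split.
  by apply: le_lt_trans p1 _; lra.
by apply: le_lt_trans p2 _; lra.
Qed.

(** The divergence theorem for a compactly supported field, one component at a
    time: integrate first along the direction of differentiation. *)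
Lemma integral2_dr_eq0 A dA K : compact K ->
  (forall p, is_derive p (1 : R, 0 : R) A (dA p)) -> continuous dA ->
  (forall p, ~ K p -> A p = 0) -> (forall p, ~ K p -> dA p = 0) ->
  (\int[@lebesgue2 R]_p (dA p)%:E = 0)%E.
Proof.
move=> cK dAE cdA A0 dA0.
have [M M0 MK] := compact_box cK.
have off x y : M <= `|x| -> ~ K (x, y) by move=> Mx /MK[]; rewrite ltNge Mx.
have int := continuous_eq0_off_compact_integrable cdA cK dA0.
rewrite -[LHS]/(\int[@lebesgue2 R]_p (EFin \o dA) p)%E.
rewrite -(@integral21_prod_meas1 _ _ _ _ _ (@lebesgue_measure R) (@lebesgue_measure R) _ int).
apply: integral0_eq => y _; rewrite /fubini_G.
apply: (@integral_derive_eq0 (fun x => A (x, y)) (fun x => dA (x, y)) M) => //.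
- by move=> x; exact: is_derive_line1.
- move=> x; apply: (@continuous_comp _ _ _ (fun x => (x, y)) dA); last exact: cdA.
  exact: (@cvg_pair _ _ _ _ _ _ _ _ _ id (cst (y : R)) cvg_id (cvg_cst _)).
- by move=> x Mx; apply/A0/off.
- by move=> x Mx; apply/dA0/off.
Qed.

Lemma integral2_dz_eq0 A dA K : compact K ->
  (forall p, is_derive p (0 : R, 1 : R) A (dA p)) -> continuous dA ->
  (forall p, ~ K p -> A p = 0) -> (forall p, ~ K p -> dA p = 0) ->
  (\int[@lebesgue2 R]_p (dA p)%:E = 0)%E.
Proof.
move=> cK dAE cdA A0 dA0.
have [M M0 MK] := compact_box cK.
have off x y : M <= `|y| -> ~ K (x, y) by move=> My /MK[_]; rewrite ltNge My.
have int := continuous_eq0_off_compact_integrable cdA cK dA0.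
rewrite -[LHS]/(\int[@lebesgue2 R]_p (EFin \o dA) p)%E.
rewrite -(@integral12_prod_meas1 _ _ _ _ _ (@lebesgue_measure R) (@lebesgue_measure R) _ int).
apply: integral0_eq => x _; rewrite /fubini_F.
apply: (@integral_derive_eq0 (fun y => A (x, y)) (fun y => dA (x, y)) M) => //.
- by move=> y; exact: is_derive_line2.
- move=> y; apply: (@continuous_comp _ _ _ (fun y => (x, y)) dA); last exact: cdA.
  exact: (@cvg_pair _ _ _ _ _ _ _ _ _ (cst (x : R)) id (cvg_cst _) cvg_id).
- by move=> y Mx; apply/A0/off.
- by move=> y Mx; apply/dA0/off.
Qed.

End DivergencePlane.

(** * Lower bounds for a quadratic form from a vector field *)

Lemma continuous_sqr {R : realType} {T : topologicalType} (f : T -> R) (p : T) :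
  {for p, continuous f} -> {for p, continuous (fun q => f q ^+ 2)}.
Proof.
move=> cf; rewrite (_ : (fun q => f q ^+ 2) = (fun q => f q * f q)).
  exact: cvgM.
by apply/funext => q; rewrite expr2.
Qed.

Section Barrier.
Context {R : realType}.
Variables (D K : set (R * R)).
Hypotheses (cK : compact K) (KD : K `<=` D).

Let clK : closed K.
Proof. by apply: compact_closed => //; exact: norm_hausdorff. Qed.

(** A real function of class C^1 on the plane that vanishes off [K]. *)
Definition C1_off (w : R * R -> R) : Prop :=
  Ck 1 w /\ forall p, ~ K p -> w p = 0.

Lemma integrable_off (f : R * R -> R) :
  (forall p, D p -> {for p, continuous f}) -> (forall p, ~ K p -> f p = 0) ->
  (@lebesgue2 R).-integrable setT (EFin \o f).
Proof.
move=> cf f0; apply: (continuous_eq0_off_compact_integrable _ cK f0).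
exact: (continuous_zero_extension clK KD).
Qed.

(** For a function carried by [K], integrating over [D] or over the plane is the
    same, with no measurability assumption on [D]. *)
Lemma integral_off (f : R * R -> R) :
  (forall p, D p -> {for p, continuous f}) -> (forall p, ~ K p -> f p = 0) ->
  (\int[@lebesgue2 R]_(p in D) (f p)%:E = (\int[@lebesgue2 R]_p f p)%R%:E)%E.
Proof.
move=> cf f0; have fi := integrable_off cf f0.
rewrite /Rintegral fineK; last exact: integrable_fin_num.
rewrite [LHS]integral_mkcond; congr (integral _ _ _); apply/funext => p; rewrite patchE.
by case: ifPn => // /negP; rewrite inE => nD; rewrite f0// => /KD.
Qed.

Variables (w : R * R -> R) (F1 F2 F11 F22 V W : R * R -> R).
Hypothesis w1 : C1_off w.
Hypotheses (cF1 : forall p, D p -> {for p, continuous F1})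
  (cF2 : forall p, D p -> {for p, continuous F2})
  (cF11 : forall p, D p -> {for p, continuous F11})
  (cF22 : forall p, D p -> {for p, continuous F22})
  (cV : forall p, D p -> {for p, continuous V})
  (cW : forall p, D p -> {for p, continuous W}).
Hypotheses (dF1 : forall p, D p -> is_derive p (1 : R, 0 : R) F1 (F11 p))
  (dF2 : forall p, D p -> is_derive p (0 : R, 1 : R) F2 (F22 p)).
Hypothesis WV : forall p, D p ->
  W p <= F11 p + F22 p - F1 p ^+ 2 - F2 p ^+ 2 + V p.

(** Density of the quadratic form with potential [V]. *)
Definition energy (w V : R * R -> R) (p : R * R) : R :=
  d_r w p ^+ 2 + d_z w p ^+ 2 + V p * w p ^+ 2.

Let w0 p : ~ K p -> w p = 0. Proof. by case: w1 => _; exact. Qed.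
Let cw : continuous w. Proof. by case: w1 => -[]. Qed.
Let cwr : continuous (d_r w). Proof. by case: w1 => -[_ [_ _ [? _] _]]. Qed.
Let cwz : continuous (d_z w). Proof. by case: w1 => -[_ [_ _ _ [? _]]]. Qed.
Let dwr p : is_derive p (1 : R, 0 : R) w (d_r w p).
Proof. by case: w1 => -[_ [dw _ _ _]] _; exact/derivableP. Qed.
Let dwz p : is_derive p (0 : R, 1 : R) w (d_z w p).
Proof. by case: w1 => -[_ [_ dw _ _]] _; exact/derivableP. Qed.
Let wr0 p : ~ K p -> d_r w p = 0.
Proof. by move=> nK; case: (is_derive_eq0_off_closed (1 : R, 0 : R) clK w0 nK). Qed.
Let wz0 p : ~ K p -> d_z w p = 0.
Proof. by move=> nK; case: (is_derive_eq0_off_closed (0 : R, 1 : R) clK w0 nK). Qed.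

Lemma energy_off p : ~ K p -> energy w V p = 0.
Proof. by move=> nK; rewrite /energy wr0// wz0// w0// expr0n/= !(mulr0, addr0). Qed.

Lemma energy_continuous p : D p -> {for p, continuous (energy w V)}.
Proof.
move=> Dp; apply: cvgD; first by apply: cvgD; apply: continuous_sqr; [exact: cwr|exact: cwz].
by apply: cvgM; [exact: cV|apply: continuous_sqr; exact: cw].
Qed.

Lemma weighted_sqr_off p : ~ K p -> W p * w p ^+ 2 = 0.
Proof. by move=> nK; rewrite w0// expr0n/= mulr0. Qed.

Lemma weighted_sqr_continuous p : D p -> {for p, continuous (fun p => W p * w p ^+ 2)}.
Proof. by move=> Dp; apply: cvgM; [exact: cW|apply: continuous_sqr; exact: cw]. Qed.

(** Expanding [|grad w + w F|^2 >= 0] and integrating [div (w^2 F)] to zero shows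
    that [div F - |F|^2] is a lower bound for the Dirichlet form. The field
    [F = (F1, F2)] is only defined on [D] and needs no boundary condition. *)
Lemma vector_field_barrier :
  (\int[@lebesgue2 R]_p (W p * w p ^+ 2) <= \int[@lebesgue2 R]_p energy w V p)%R.
Proof.
pose A p := F1 p * w p ^+ 2; pose B p := F2 p * w p ^+ 2.
pose dA p := F11 p * w p ^+ 2 + F1 p * (2 * w p * d_r w p).
pose dB p := F22 p * w p ^+ 2 + F2 p * (2 * w p * d_z w p).
have A0 p : ~ K p -> A p = 0 by move=> nK; rewrite /A w0// expr0n/= mulr0.
have B0 p : ~ K p -> B p = 0 by move=> nK; rewrite /B w0// expr0n/= mulr0.
have dA0 p : ~ K p -> dA p = 0.
  by move=> nK; rewrite /dA w0// expr0n/= !(mulr0, mul0r, addr0).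
have dB0 p : ~ K p -> dB p = 0.
  by move=> nK; rewrite /dB w0// expr0n/= !(mulr0, mul0r, addr0).
have cdA p : D p -> {for p, continuous dA}.
  move=> Dp; apply: cvgD; apply: cvgM; [exact: cF11| |exact: cF1|].
    by apply: continuous_sqr; exact: cw.
  by apply: cvgM; [apply: cvgM; [exact: cvg_cst|exact: cw]|exact: cwr].
have cdB p : D p -> {for p, continuous dB}.
  move=> Dp; apply: cvgD; apply: cvgM; [exact: cF22| |exact: cF2|].
    by apply: continuous_sqr; exact: cw.
  by apply: cvgM; [apply: cvgM; [exact: cvg_cst|exact: cw]|exact: cwz].
have dAE p : is_derive p (1 : R, 0 : R) A (dA p).
  have [Kp|nK] := pselect (K p); last first.
    by rewrite dA0//; exact: (is_derive_eq0_off_closed _ clK).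
  apply: (is_derive_eq (is_deriveM (dF1 (KD Kp)) (is_deriveX 2 (dwr p)))).
  by rewrite /dA /= /GRing.scale/= expr1 exprfctE; ring.
have dBE p : is_derive p (0 : R, 1 : R) B (dB p).
  have [Kp|nK] := pselect (K p); last first.
    by rewrite dB0//; exact: (is_derive_eq0_off_closed _ clK).
  apply: (is_derive_eq (is_deriveM (dF2 (KD Kp)) (is_deriveX 2 (dwz p)))).
  by rewrite /dB /= /GRing.scale/= expr1 exprfctE; ring.
have IA : (\int[@lebesgue2 R]_p dA p = 0)%R.
  have cA := continuous_zero_extension clK KD cdA dA0.
  by rewrite /Rintegral (integral2_dr_eq0 cK dAE cA A0 dA0).
have IB : (\int[@lebesgue2 R]_p dB p = 0)%R.
  have cB := continuous_zero_extension clK KD cdB dB0.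
  by rewrite /Rintegral (integral2_dz_eq0 cK dBE cB B0 dB0).
have iA := integrable_off cdA dA0; have iB := integrable_off cdB dB0.
have iE := integrable_off energy_continuous energy_off.
have iW := integrable_off weighted_sqr_continuous weighted_sqr_off.
have iAB : (@lebesgue2 R).-integrable setT (EFin \o (fun p => dA p + dB p)).
  exact: (integrableD measurableT iA iB).
have iEAB : (@lebesgue2 R).-integrable setT
    (EFin \o (fun p => energy w V p + (dA p + dB p))).
  exact: (integrableD measurableT iE iAB).
have -> : (\int[@lebesgue2 R]_p energy w V p =
           \int[@lebesgue2 R]_p (energy w V p + (dA p + dB p)))%R.
  rewrite [RHS](RintegralD measurableT iE iAB).
  rewrite [X in _ + X](RintegralD measurableT iA iB).
  by rewrite [X in _ + (X + _)]IA [X in _ + (_ + X)]IB !addr0.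
apply: le_Rintegral => //.
move=> p _; have [Kp|nK] := pselect (K p); last first.
  by rewrite dA0// dB0// energy_off// w0// expr0n/= mulr0 !addr0.
have := WV (KD Kp); rewrite -subr_ge0 => h.
rewrite -subr_ge0.
(* completion of the square *)
have -> : energy w V p + (dA p + dB p) - W p * w p ^+ 2 =
  (d_r w p + F1 p * w p) ^+ 2 + (d_z w p + F2 p * w p) ^+ 2 +
  (F11 p + F22 p - F1 p ^+ 2 - F2 p ^+ 2 + V p - W p) * w p ^+ 2.
  by rewrite /energy /dA /dB; ring.
by rewrite !addr_ge0 ?sqr_ge0// mulr_ge0 ?sqr_ge0.
Qed.

End Barrier.

(** * Functions of class C^1 in rotated coordinates *)

Section RotatedC1.
Context {R : realType}.
Variables (co si : R) (D : set (R * R)).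

(** Coordinates with respect to the frame [(co, -si)], [(si, co)]: [s] runs
    across the strip and [t] along it. *)
Definition rot_s (p : R * R) : R := p.1 * co - p.2 * si.
Definition rot_t (p : R * R) : R := p.1 * si + p.2 * co.

(** [f] is of class C^1 at the points of [D], with partial derivatives [fs] and
    [ft] in the rotated coordinates. Recording the full differential lets the
    derivatives along the original axes be read off without rotating the
    measure. *)
Definition C1 (f fs ft : R * R -> R) : Prop := forall p, D p ->
  [/\ {for p, continuous fs}, {for p, continuous ft} &
      is_diff p f (fun v => fs p * rot_s v + ft p * rot_t v)].

Implicit Types f g fs ft gs gt : R * R -> R.

Lemma C1_continuous f fs ft p : C1 f fs ft -> D p -> {for p, continuous f}.
Proof.
move=> cf Dp; have [_ _ df] := cf p Dp; apply: differentiable_continuous.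
exact: ex_diff.
Qed.

Lemma C1_is_derive f fs ft p v : C1 f fs ft -> D p ->
  is_derive p v f (fs p * rot_s v + ft p * rot_t v).
Proof.
move=> cf Dp; have [_ _ df] := cf p Dp.
by split; [apply: diff_derivable; exact: ex_diff|rewrite deriveE ?diff_val].
Qed.

Lemma C1_cst (k : R) : C1 (cst k) (cst 0) (cst 0).
Proof.
move=> p Dp; split; [exact: cvg_cst|exact: cvg_cst|].
by apply: (is_diff_eq (is_diff_cst k p)); apply/funext => v; rewrite /= !mul0r addr0.
Qed.

Lemma is_diff_fst (p : R * R) : is_diff p (fst : R * R -> R) fst.
Proof.
pose L : {linear (R * R)%type -> R} := fst.
have cL : continuous (L : R * R -> R) by move=> q; exact: cvg_fst.
by split; [exact: (linear_differentiable p cL)|exact: (diff_lin p cL)].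
Qed.

Lemma is_diff_snd (p : R * R) : is_diff p (snd : R * R -> R) snd.
Proof.
pose L : {linear (R * R)%type -> R} := snd.
have cL : continuous (L : R * R -> R) by move=> q; exact: cvg_snd.
by split; [exact: (linear_differentiable p cL)|exact: (diff_lin p cL)].
Qed.

Lemma C1_s : C1 rot_s (cst 1) (cst 0).
Proof.
move=> p Dp; split; [exact: cvg_cst|exact: cvg_cst|].
have df := is_diff_fst p; have ds := is_diff_snd p.
have E : rot_s = co *: (fst : R * R -> R) - si *: (snd : R * R -> R).
  by apply/funext => q; rewrite /rot_s /= /GRing.scale/= mulrC [q.2 * _]mulrC.
rewrite [X in is_diff p X]E.
apply: (is_diff_eq (is_diffB (is_diffZ co df) (is_diffZ si ds))).
by apply/funext => v; rewrite /= E mul1r mul0r addr0.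
Qed.

Lemma C1_t : C1 rot_t (cst 0) (cst 1).
Proof.
move=> p Dp; split; [exact: cvg_cst|exact: cvg_cst|].
have df := is_diff_fst p; have ds := is_diff_snd p.
have E : rot_t = si *: (fst : R * R -> R) + co *: (snd : R * R -> R).
  by apply/funext => q; rewrite /rot_t /= /GRing.scale/= mulrC [q.2 * _]mulrC.
rewrite [X in is_diff p X]E.
apply: (is_diff_eq (is_diffD (is_diffZ si df) (is_diffZ co ds))).
by apply/funext => v; rewrite /= E mul1r mul0r add0r.
Qed.

Lemma C1_D f fs ft g gs gt : C1 f fs ft -> C1 g gs gt ->
  C1 (fun p => f p + g p) (fun p => fs p + gs p) (fun p => ft p + gt p).
Proof.
move=> Cf Cg p Dp; have [cfs cft df] := Cf p Dp; have [cgs cgt dg] := Cg p Dp.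
split; [exact: cvgD|exact: cvgD|].
apply: (is_diff_eq (is_diffD df dg)).
by apply/funext => v; rewrite addrfctE; ring.
Qed.

Lemma C1_M f fs ft g gs gt : C1 f fs ft -> C1 g gs gt ->
  C1 (fun p => f p * g p) (fun p => f p * gs p + fs p * g p)
     (fun p => f p * gt p + ft p * g p).
Proof.
move=> Cf Cg p Dp; have [cfs cft df] := Cf p Dp; have [cgs cgt dg] := Cg p Dp.
have cf := C1_continuous Cf Dp; have cg := C1_continuous Cg Dp.
split; [by apply: cvgD; exact: cvgM|by apply: cvgD; exact: cvgM|].
apply: (is_diff_eq (is_diffM df dg)).
by apply/funext => v; rewrite addrfctE /GRing.scale/= /GRing.scale/=; ring.
Qed.

Lemma C1_comp (h h' : R -> R) f fs ft : C1 f fs ft ->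
  (forall p, D p -> is_derive (f p) 1 h (h' (f p))) ->
  (forall p, D p -> {for f p, continuous h'}) ->
  C1 (fun p => h (f p)) (fun p => h' (f p) * fs p) (fun p => h' (f p) * ft p).
Proof.
move=> Cf dh ch p Dp; have [cfs cft df] := Cf p Dp.
have cf := C1_continuous Cf Dp.
have chf : {for p, continuous (fun q => h' (f q))}.
  by apply: continuous_comp => //; exact: ch.
split; [exact: cvgM|exact: cvgM|].
have dhp : is_diff (f p) h ( *:%R^~ (h' (f p))).
  have [hd hE] := dh p Dp; have hdiff : differentiable h (f p) by exact/derivable1_diffP.
  by split => //; rewrite diff1E// derive1E hE.
apply: (is_diff_eq (is_diff_comp df dhp)).
by apply/funext => v /=; rewrite /GRing.scale/=; ring.
Qed.

Lemma C1_V f fs ft : C1 f fs ft -> (forall p, D p -> f p != 0) ->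
  C1 (fun p => (f p)^-1) (fun p => - (f p) ^- 2 * fs p)
     (fun p => - (f p) ^- 2 * ft p).
Proof.
move=> Cf f0; apply: (@C1_comp _ (fun x => - x ^- 2) _ _ _ Cf) => p Dp.
  have d := @is_deriveV R id (f p) 1 1 (f0 p Dp) (is_derive_id _ _).
  by apply: (is_derive_eq d); rewrite /GRing.scale/= mulr1.
apply: cvgN; apply: cvgV; first by rewrite sqrf_eq0 f0.
exact: continuous_sqr.
Qed.

End RotatedC1.

(** * Elementary real inequalities *)

Section RealFacts.
Context {R : realType}.
Implicit Types x y s : R.

Lemma sin_ge_mulcos x : 0 <= x <= pi -> x * cos x <= sin x.
Proof.
move=> /andP[x0 xpi].
have [c cx] := @MVT_segment R sin cos 0 x x0 (fun y _ => is_derive_sin y)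
  (continuous_subspaceT (@continuous_sin R)).
rewrite sin0 !subr0 => ->; rewrite mulrC ler_wpM2r//.
move: cx; rewrite in_itv/= => /andP[c0 cx'].
have [->//|cx] := eqVneq c x.
apply/ltW; rewrite ltr_cos ?in_itv/= ?x0 ?c0//=; last exact: le_trans xpi.
by rewrite lt_neqAle cx.
Qed.

Lemma sin_le_id x : 0 <= x -> sin x <= x.
Proof.
move=> x0.
have [c cx] := @MVT_segment R sin cos 0 x x0 (fun y _ => is_derive_sin y)
  (continuous_subspaceT (@continuous_sin R)).
by rewrite sin0 !subr0 => ->; rewrite ler_piMl// cos_le1.
Qed.

Lemma sin_double x : sin (x * 2) = 2 * (sin x * cos x).
Proof. by rewrite mulr_natr sin_mulr2n -mulr_natr; ring. Qed.

Lemma cos_double x : cos (x * 2) = 2 * cos x ^+ 2 - 1.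
Proof. by rewrite mulr_natr cos_mulr2n -mulr_natr; ring. Qed.

Lemma sin_ge_quarter x : 0 <= x <= pi / 2 -> x / 4 <= sin x.
Proof.
move=> /andP[x0 xpi]; have pi0 := pi_gt0 R.
have [y xy] : exists y, x = y * 2 by exists (x / 2); lra.
rewrite {}xy in x0 xpi *.
have y0 : 0 <= y by lra.
have cy : 0 <= cos y by apply: cos_ge0_pihalf; apply/andP; split; lra.
have c2y : 1 / 2 <= cos y ^+ 2.
  have : 0 <= cos (y * 2) by apply: cos_ge0_pihalf; apply/andP; split; lra.
  by rewrite cos_double; lra.
have sy : y * cos y <= sin y by apply: sin_ge_mulcos; apply/andP; split; lra.
have : y * cos y ^+ 2 <= sin y * cos y by rewrite expr2 mulrA ler_wpM2r.
have : y * (1 / 2) <= y * cos y ^+ 2 by rewrite ler_wpM2l.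
rewrite sin_double; lra.
Qed.

(** The two zeros of [sin] on the closed interval are simple. *)
Lemma sin_ge_parabola s : 0 < s < pi -> s * (pi - s) / 32 <= sin s.
Proof.
move=> /andP[s0 spi].
have [x xs] : exists x, s = x * 2 by exists (s / 2); lra.
rewrite {}xs in s0 spi *.
have h1 : x / 4 <= sin x by apply: sin_ge_quarter; apply/andP; split; lra.
have h2 : (pi / 2 - x) / 4 <= cos x.
  have -> : cos x = sin (pi / 2 - x).
    by rewrite -[LHS]cosN -sinDpihalf addrC.
  by apply: sin_ge_quarter; apply/andP; split; lra.
rewrite sin_double.
have : x / 4 * ((pi / 2 - x) / 4) <= sin x * cos x by apply: ler_pM => //; lra.
lra.
Qed.

Lemma ln_ge_subV x : 0 < x -> 1 - x^-1 <= ln x.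
Proof.
move=> x0; have xV : 0 < x^-1 by rewrite invr_gt0.
have : ln (1 + (x^-1 - 1)) <= x^-1 - 1 by apply: le_ln1Dx; lra.
rewrite addrC subrK lnV ?posrE//; lra.
Qed.

(** Cube of the positive part, a C^1 function, and its derivative. *)
Definition pos_cube x : R := Num.max 0 x ^+ 3.
Definition dpos_cube x : R := 3 * Num.max 0 x ^+ 2.

Lemma continuous_max0 : continuous (fun x : R => Num.max 0 x).
Proof.
move=> x; apply: (@continuous_max R R (cst 0) id); [exact: cvg_cst|exact: cvg_id].
Qed.

Lemma continuous_dpos_cube : continuous dpos_cube.
Proof.
by move=> x; apply: cvgM; [exact: cvg_cst|apply: continuous_sqr; exact: continuous_max0].
Qed.

Lemma is_derive_pos_cube x : is_derive x 1 pos_cube (dpos_cube x).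
Proof.
have [x0|x0|->] := ltgtP x 0.
- have -> : dpos_cube x = 0 by rewrite /dpos_cube max_l ?ltW// expr0n/= mulr0.
  apply: (near_eq_is_derive _ (is_derive_cst (0 : R) x 1)).
  near=> y; rewrite /= /pos_cube max_l ?expr0n//; apply/ltW; near: y; exact: lt_nbhsl.
- have -> : dpos_cube x = 3 * x ^+ 2 by rewrite /dpos_cube max_r ?ltW.
  have d : is_derive x 1 (id ^+ 3) ((3%:R * x ^+ 2) *: (1 : R)) by exact: is_deriveX.
  rewrite -[3 * x ^+ 2]mulr1; apply: (near_eq_is_derive _ d).
  near=> y; rewrite exprfctE /= /pos_cube max_r//; apply/ltW; near: y; exact: lt_nbhsr.
- have -> : dpos_cube 0 = 0 by rewrite /dpos_cube maxxx expr0n/= mulr0.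
  apply/is_derive1_caratheodory; exists (fun z => Num.max 0 z ^+ 2); split.
  + move=> z; rewrite /pos_cube maxxx expr0n/= !subr0.
    by have [z0|z0] := leP z 0; [rewrite !expr0n/= mul0r|rewrite -exprSr].
  + by apply: continuous_sqr; exact: continuous_max0.
  + by rewrite maxxx expr0n.
Unshelve. all: by end_near. Qed.

End RealFacts.

(** * The vector field *)

Section VectorField.
Context {R : realType}.
Variables (co si : R) (D : set (R * R)).
Hypotheses (co0 : 0 < co) (si0 : 0 < si) (cosi : co ^+ 2 + si ^+ 2 = 1).
Hypothesis strip : forall p, D p -> 0 < p.1 /\ 0 < rot_s co si p < pi.
Variables (eps delta : R).

Local Notation S := (rot_s co si).
Local Notation T := (rot_t co si).
Local Notation C1 := (C1 co si D).

(** Cotangent of the angle. *)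
Definition slope : R := co / si.
(** The distance to the left edge of the domain measured along the [t] axis; by
    [rho_coordE] it is the first coordinate divided by [si]. *)
Definition rho_coord (p : R * R) : R := T p + slope * S p.
(** Argument of the logarithm: it exceeds 1 when [rho_coord] is larger than half
    the value [slope * S p] that it takes where [t = 0]. *)
Definition log_ratio (p : R * R) : R := 2 * rho_coord p / (slope * S p).
(** Regularised logarithm. The term in [y^-2] keeps [y^2 m(y)] bounded away from
    0 near 0; it turns [y m'(y)] into [1 - 1/(2 y^2)], still at least [1/2] for
    [1 <= y]. *)
Definition log_profile (y : R) : R := 1 + ln y + (4 * y ^+ 2)^-1.
(** Where [t < 0] the strip is cut at the abscissa [s = depth p]. *)
Definition depth (p : R * R) : R := - (T p / slope).

(** The two components of the vector field in the rotated frame. The leading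
    terms are minus the logarithmic derivatives of [sin s] and of the square
    root of [rho]; they saturate the Poincare inequality across the strip and
    the Hardy inequality along it. *)
Definition field_s (p : R * R) : R :=
  - (cos (S p) / sin (S p))
  - eps * pos_cube (depth p) * ((pi - S p) / sin (S p) ^+ 2).
Definition field_t (p : R * R) : R :=
  - (2 * rho_coord p)^-1 - delta * S p ^+ 3 / (log_profile (log_ratio p) * rho_coord p).

Let slope0 : 0 < slope. Proof. by rewrite divr_gt0. Qed.

Lemma rho_coordE p : rho_coord p = p.1 / si.
Proof.
rewrite /rho_coord /slope /rot_s /rot_t.
have -> : p.1 * si + p.2 * co + co / si * (p.1 * co - p.2 * si) =
  p.1 * (co ^+ 2 + si ^+ 2) / si by field; rewrite gt_eqF.
by rewrite cosi mulr1.
Qed.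

Let S0 p : D p -> 0 < S p. Proof. by move=> /strip[_ /andP[]]. Qed.
Let sin0 p : D p -> 0 < sin (S p).
Proof. by move=> /strip[_ ?]; exact: sin_gt0_pi. Qed.
Let rho0 p : D p -> 0 < rho_coord p.
Proof. by move=> /strip[? _]; rewrite rho_coordE divr_gt0. Qed.
Let ratio0 p : D p -> 0 < log_ratio p.
Proof. by move=> Dp; rewrite /log_ratio divr_gt0 // mulr_gt0 ?rho0 ?S0. Qed.

Lemma log_profile_ge1 y : 0 < y -> 1 <= log_profile y.
Proof.
move=> y0; have := ln_ge_subV y0.
have -> : log_profile y = 1 + ln y + (y^-1) ^+ 2 / 4.
  by rewrite /log_profile invfM exprVn; ring.
have := sqr_ge0 (y^-1 / 2 - 1); lra.
Qed.

(** Only the derivative across the strip has to be known explicitly, the other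
    one cancels in the divergence; symmetrically for [field_t]. *)
Lemma field_s_C1 : exists fs ft, C1 field_s fs ft /\ forall p, D p ->
  fs p = (sin (S p) ^+ 2)^-1 + eps * pos_cube (depth p) *
    ((sin (S p) ^+ 2)^-1 + 2 * (pi - S p) * cos (S p) / sin (S p) ^+ 3).
Proof.
(* the same function, spelled with the operations under which C1 is stable *)
have -> : field_s = fun p => (-1) * (cos (S p) * (sin (S p))^-1) +
   (- eps) * (pos_cube (T p * - slope^-1) *
     ((pi + (-1) * S p) * ((sin (S p))^-1 * (sin (S p))^-1))).
  by apply/funext => p; rewrite /field_s /depth mulrN -exprVn; ring.
have ccst k := @C1_cst _ co si D k.
have cN x : {for x, continuous (fun x : R => - sin x)}.
  by apply: cvgN; exact: continuous_sin.
have Csin := C1_comp (@C1_s _ co si D) (fun p _ => is_derive_sin (S p))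
  (fun p _ => @continuous_cos _ _).
have Ccos := C1_comp (h' := fun x => - sin x) (@C1_s _ co si D) (fun p _ => is_derive_cos (S p))
  (fun p _ => cN _).
have CsinV := C1_V Csin (fun p Dp => lt0r_neq0 (sin0 Dp)).
have Cd := C1_comp (C1_M (@C1_t _ co si D) (ccst (- slope^-1)))
  (fun p _ => is_derive_pos_cube _) (fun p _ => @continuous_dpos_cube _ _).
do 2 eexists; split.
  exact: (C1_D (C1_M (ccst (-1)) (C1_M Ccos CsinV))
    (C1_M (ccst (- eps)) (C1_M Cd
      (C1_M (C1_D (ccst pi) (C1_M (ccst (-1)) (@C1_s _ co si D))) (C1_M CsinV CsinV))))).
move=> p Dp; rewrite /=.
have sn := lt0r_neq0 (sin0 Dp).
rewrite /depth mulrN.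
transitivity ((cos (S p) ^+ 2 + sin (S p) ^+ 2) * (sin (S p) ^+ 2)^-1 +
  eps * pos_cube (- (T p / slope)) *
    ((sin (S p) ^+ 2)^-1 + 2 * (pi - S p) * cos (S p) / sin (S p) ^+ 3)).
  by field; rewrite sn lt0r_neq0.
by rewrite cos2Dsin2 mul1r.
Qed.

Lemma field_t_C1 : exists fs ft, C1 field_t fs ft /\ forall p, D p ->
  ft p = (2 * rho_coord p ^+ 2)^-1 + delta * S p ^+ 3 *
    (1 - (2 * log_ratio p ^+ 2)^-1 + log_profile (log_ratio p)) /
    (log_profile (log_ratio p) * rho_coord p) ^+ 2.
Proof.
have -> : field_t = fun p => (- 2^-1) * (rho_coord p)^-1 + (- delta) *
   ((S p * (S p * S p)) * (log_profile (log_ratio p) * rho_coord p)^-1).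
  by apply/funext => p; rewrite /field_t [(2 * _)^-1]invfM; ring.
have ccst k := @C1_cst _ co si D k.
have Cs := @C1_s _ co si D; have Ct := @C1_t _ co si D.
have Crho := C1_D Ct (C1_M (ccst slope) Cs).
have CrhoV := C1_V Crho (fun p Dp => lt0r_neq0 (rho0 Dp)).
have CSV := C1_V Cs (fun p Dp => lt0r_neq0 (S0 Dp)).
have Cy : exists fs ft, C1 log_ratio fs ft /\ forall p, D p -> ft p = 2 / (slope * S p).
  have -> : log_ratio = fun p => (2 / slope) * (rho_coord p * (S p)^-1).
    by apply/funext => p; rewrite /log_ratio [(_ * S p)^-1]invfM; ring.
  do 2 eexists; split; first exact: (C1_M (ccst (2 / slope)) (C1_M Crho CSV)).
  move=> p Dp /=; have s0 := lt0r_neq0 (S0 Dp); have a0 := lt0r_neq0 slope0.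
  by field; rewrite s0 a0.
have [ys [yt [{}Cy ytE]]] := Cy.
have Cm : C1 (fun p => log_profile (log_ratio p))
    (fun p => ((log_ratio p)^-1 - (2 * log_ratio p ^+ 3)^-1) * ys p)
    (fun p => ((log_ratio p)^-1 - (2 * log_ratio p ^+ 3)^-1) * yt p).
  apply: (C1_comp (h' := fun y => y^-1 - (2 * y ^+ 3)^-1) Cy) => p Dp.
    have y0 := ratio0 Dp; have yn := lt0r_neq0 y0.
    have dl := is_derive1_ln y0.
    have dv := @is_deriveV R id (log_ratio p) 1 1 yn (is_derive_id _ _).
    have -> : log_profile = cst 1 + (@ln R + (1 / 4) *: ((fun y : R => (id y)^-1) ^+ 2)).
      apply/funext => y; transitivity (1 + (ln y + 1 / 4 * y^-1 ^+ 2)); last by [].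
      by rewrite /log_profile (invfM 4) -exprVn; ring.
    have dX := is_deriveX 2 dv.
    have dZ := is_deriveZ (1 / 4) dX.
    have dS := is_deriveD (is_derive_cst (1 : R) (log_ratio p) (1 : R)) (is_deriveD dl dZ).
    apply: (is_derive_eq dS).
    by rewrite /GRing.scale/=; field.
  have y0 := lt0r_neq0 (ratio0 Dp).
  apply: cvgB; first exact: cvgV.
  apply: cvgV; first by rewrite mulf_neq0// expf_neq0.
  by apply: cvgM; [exact: cvg_cst|exact: exprn_continuous].
have mr0 p : D p -> log_profile (log_ratio p) * rho_coord p != 0.
  move=> Dp; rewrite lt0r_neq0// mulr_gt0 ?rho0//.
  by rewrite (lt_le_trans ltr01)// log_profile_ge1// ratio0.
do 2 eexists; split.
  exact: (C1_D (C1_M (ccst (- 2^-1)) CrhoV) (C1_M (ccst (- delta))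
    (C1_M (C1_M Cs (C1_M Cs Cs)) (C1_V (C1_M Cm Crho) mr0)))).
move=> p Dp /=.
have := mr0 p Dp; rewrite mulf_eq0 negb_or => /andP[m0 r0].
have s0 := lt0r_neq0 (S0 Dp); have a0 := lt0r_neq0 slope0.
have y0 := lt0r_neq0 (ratio0 Dp).
rewrite -/(rho_coord p) (ytE p Dp).
have -> : 2 / (slope * S p) = log_ratio p / rho_coord p.
  by rewrite /log_ratio; field; rewrite s0 a0 r0.
move: (log_profile _) m0 => m m0; move: (log_ratio p) y0 => y y0.
by field; rewrite m0 y0 r0.
Qed.
End VectorField.

(** * Gains and losses of the two components *)

Section Pointwise.
Context {R : realType}.

(** Excess of [field_s] over the first Dirichlet eigenvalue, with [x], [c] for
    sine and cosine of [s] and [q] for [pi - s]. *)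
Lemma transverse_gain (A q c x : R) : 0 < x -> c ^+ 2 + x ^+ 2 = 1 -> 0 <= A ->
  A * q ^+ 2 <= x ^+ 2 / 2 ->
  A / (2 * x ^+ 2) <=
  (x ^+ 2)^-1 + A * ((x ^+ 2)^-1 + 2 * q * c / x ^+ 3)
  - (- (c / x) - A * (q / x ^+ 2)) ^+ 2 - 1.
Proof.
move=> x0 cx A0 Aq; have xn := lt0r_neq0 x0; rewrite -subr_ge0.
have -> : (x ^+ 2)^-1 + A * ((x ^+ 2)^-1 + 2 * q * c / x ^+ 3)
  - (- (c / x) - A * (q / x ^+ 2)) ^+ 2 - 1 - A / (2 * x ^+ 2)
  = (1 - (c ^+ 2 + x ^+ 2)) / x ^+ 2 + A / x ^+ 4 * (x ^+ 2 / 2 - A * q ^+ 2).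
  by field.
by rewrite cx subrr mul0r add0r mulr_ge0 ?subr_ge0// divr_ge0// exprn_ge0// ltW.
Qed.

(** Excess of [field_t] over the critical Hardy potential, [m] being a value of
    [log_profile] and [e] the amplitude of the perturbation. *)
Lemma longitudinal_gain (e m y r : R) : 0 < m -> 0 < y -> 0 < r ->
  (2 * r ^+ 2)^-1 + e * (1 - (2 * y ^+ 2)^-1 + m) / (m * r) ^+ 2
  - (- (2 * r)^-1 - e / (m * r)) ^+ 2 - (4 * r ^+ 2)^-1
  = e * (1 - (2 * y ^+ 2)^-1 - e) / (m * r) ^+ 2.
Proof.
move=> m0 y0 r0; field.
by rewrite !lt0r_neq0.
Qed.

Lemma log_profile_sqr_ge (y : R) : 0 < y -> 1 / 8 <= y ^+ 2 * log_profile y.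
Proof.
move=> y0; have l := ln_ge_subV y0.
have -> : y ^+ 2 * log_profile y = y ^+ 2 + y ^+ 2 * ln y + 1 / 4.
  by rewrite /log_profile; field; rewrite lt0r_neq0.
have h : y ^+ 2 * (1 - y^-1) <= y ^+ 2 * ln y by rewrite ler_wpM2l ?sqr_ge0.
have e : y ^+ 2 * (1 - y^-1) = y ^+ 2 - y by field; rewrite lt0r_neq0.
rewrite e in h; have := sqr_ge0 (y - 1 / 4); lra.
Qed.

(** For [1 <= y] the longitudinal excess is positive and dominates a multiple of
    the Hardy weight. *)
Lemma far_gain (a s r y d P : R) : 0 < a -> 0 < s -> s < P -> 0 < r -> 1 <= y ->
  r = a * s * y / 2 -> 0 < d -> d * s ^+ 3 <= 1 / 4 ->
  d / (4 * (4 * a ^+ 2 * P ^+ 2 + 18)) * (s ^+ 3 / (1 + r ^+ 2 * ln y ^+ 2)) <=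
  d * s ^+ 3 * (1 - (2 * y ^+ 2)^-1 - d * s ^+ 3) / (log_profile y * r) ^+ 2.
Proof.
move=> a0 s0 sP r0 y1 rE d0 ds.
have y0 : 0 < y by lra.
have l0 : 0 <= ln y by exact: ln_ge0.
have m1 := log_profile_ge1 y0.
have y2 : (y ^+ 2)^-1 <= 1 by rewrite invf_le1 ?exprn_gt0// expr_ge1// ltW.
have mle : log_profile y <= 5 / 4 + ln y.
  by rewrite /log_profile invfM; lra.
set l := ln y in l0 mle *; set m := log_profile y in m1 mle *.
have r2 : r ^+ 2 <= a ^+ 2 * P ^+ 2 + 4 * (r ^+ 2 * l ^+ 2).
  have rl0 : 0 <= r ^+ 2 * l ^+ 2 by rewrite mulr_ge0 ?sqr_ge0.
  have aP0 : 0 <= a ^+ 2 * P ^+ 2 by rewrite mulr_ge0 ?sqr_ge0.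
  have [yle|yge] := leP y 2.
    have sy : s * y <= P * 2 by apply: ler_pM; lra.
    have : a * (s * y) <= a * (P * 2) by rewrite ler_wpM2l// ltW.
    move=> asy; have rP : r <= a * P by lra.
    have : r ^+ 2 <= (a * P) ^+ 2 by rewrite lerXn2r// nnegrE; lra.
    by rewrite exprMn; lra.
  have : 1 / 2 <= l.
    have := ln_ge_subV y0; have : y^-1 <= 2^-1 by rewrite lef_pV2 ?posrE// ltW.
    rewrite /l; lra.
  move=> l2; have : (1 / 2) ^+ 2 <= l ^+ 2 by rewrite lerXn2r// nnegrE; lra.
  move=> l4; have : r ^+ 2 * (1 / 2) ^+ 2 <= r ^+ 2 * l ^+ 2 by rewrite ler_wpM2l ?sqr_ge0.
  by lra.
have m2 : m ^+ 2 <= 4 + 2 * l ^+ 2.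
  have : m ^+ 2 <= (5 / 4 + l) ^+ 2 by rewrite lerXn2r// nnegrE; lra.
  have := sqr_ge0 (l - 5 / 4); lra.
set w := 1 + r ^+ 2 * l ^+ 2.
have w0 : 0 < w by rewrite /w ltr_pwDl// mulr_ge0 ?sqr_ge0.
have mr : (m * r) ^+ 2 <= (4 * a ^+ 2 * P ^+ 2 + 18) * w.
  have h1 : (m * r) ^+ 2 <= (4 + 2 * l ^+ 2) * r ^+ 2.
    by rewrite exprMn ler_wpM2r ?sqr_ge0.
  have rl0 : 0 <= r ^+ 2 * l ^+ 2 by rewrite mulr_ge0 ?sqr_ge0.
  have aP0 : 0 <= a ^+ 2 * P ^+ 2 by rewrite mulr_ge0 ?sqr_ge0.
  have h2 := mulr_ge0 aP0 rl0; rewrite /w; lra.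
have mr0 : 0 < (m * r) ^+ 2 by rewrite exprn_gt0// mulr_gt0//; lra.
have k0 : 0 < 4 * a ^+ 2 * P ^+ 2 + 18.
  have : 0 <= a ^+ 2 * P ^+ 2 by rewrite mulr_ge0 ?sqr_ge0.
  lra.
have e0 : 0 < d * s ^+ 3 by rewrite mulr_gt0 ?exprn_gt0.
apply: (@le_trans _ _ (d * s ^+ 3 * (1 / 4) / (m * r) ^+ 2)); last first.
  rewrite ler_pM2r ?invr_gt0// ler_pM2l//.
  by rewrite invfM; lra.
set k := (4 * a ^+ 2 * P ^+ 2 + 18) in mr k0 *.
rewrite ler_pdivlMr//.
have -> : d / (4 * k) * (s ^+ 3 / w) * (m * r) ^+ 2 =
  (d * s ^+ 3 / (4 * k * w)) * (m * r) ^+ 2.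
  by field; rewrite !lt0r_neq0.
rewrite mulrAC ler_pdivrMr ?mulr_gt0//.
have -> : d * s ^+ 3 * (1 / 4) * (4 * k * w) = d * s ^+ 3 * (k * w) by field.
by rewrite ler_pM2l.
Qed.

(** For all [y], hence in particular below 1, the longitudinal excess is not
    worse than a small negative multiple of [s]. *)
Lemma near_loss (a s r y d : R) : 0 < a -> 0 < s -> 0 < y ->
  r = a * s * y / 2 -> 0 < d -> d * s ^+ 3 <= 1 / 4 ->
  - (128 * d * s / a ^+ 2) <=
  d * s ^+ 3 * (1 - (2 * y ^+ 2)^-1 - d * s ^+ 3) / (log_profile y * r) ^+ 2.
Proof.
move=> a0 s0 y0 -> d0 ds.
have m8 := log_profile_sqr_ge y0; have m1 := log_profile_ge1 y0.
set m := log_profile y in m8 m1 *; have m0 : 0 < m by lra.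
have e0 : 0 < d * s ^+ 3 by rewrite mulr_gt0 ?exprn_gt0.
apply: (@le_trans _ _ (d * s ^+ 3 * (- (2 * y ^+ 2)^-1) / (m * (a * s * y / 2)) ^+ 2)).
  have -> : d * s ^+ 3 * (- (2 * y ^+ 2)^-1) / (m * (a * s * y / 2)) ^+ 2 =
    - (2 * d * s / a ^+ 2 * ((y ^+ 2 * m) ^+ 2)^-1).
    by field; rewrite !lt0r_neq0.
  rewrite lerN2.
  have -> : 128 * d * s / a ^+ 2 = 2 * d * s / a ^+ 2 * 64 by field; rewrite lt0r_neq0.
  rewrite ler_pM2l ?divr_gt0 ?mulr_gt0 ?exprn_gt0//.
  rewrite -[64]invrK lef_pV2 ?posrE ?invr_gt0 ?exprn_gt0 ?mulr_gt0 ?exprn_gt0//.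
  have -> : (64 : R)^-1 = (1 / 8) ^+ 2 by field.
  by rewrite lerXn2r// nnegrE; lra.
rewrite ler_pM2r ?invr_gt0 ?exprn_gt0 ?mulr_gt0//.
by rewrite ler_pM2l//; lra.
Qed.
End Pointwise.

(** * The pointwise lower bound *)

Section GainBound.
Context {R : realType}.
Variables (co si : R).
Hypotheses (co0 : 0 < co) (si0 : 0 < si) (cosi : co ^+ 2 + si ^+ 2 = 1).

Local Notation S := (rot_s co si).
Local Notation a := (slope co si).
Local Notation rho := (rho_coord co si).
Local Notation ratio := (log_ratio co si).

(** Amplitudes of the perturbations of the two components. [eps_const] makes the
    quadratic term of [transverse_gain] harmless; [delta_const] makes
    [near_loss] at most half of the transverse gain, and [delta_const * s^3] at
    most [1/4]. *)
Definition eps_const : R := (64 * 32 * pi)^-1.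
Definition delta_const : R := Num.min (eps_const * a ^+ 2 / (64 * 64)) (4 * pi ^+ 3)^-1.
Definition hardy_const : R :=
  Num.min (eps_const / (32 * pi ^+ 2))
    (delta_const / (4 * (4 * a ^+ 2 * pi ^+ 2 + 18))).

Let pi0 : 0 < pi :> R. Proof. exact: pi_gt0. Qed.
Let a0 : 0 < a. Proof. by rewrite divr_gt0. Qed.
Lemma eps_const_gt0 : 0 < eps_const.
Proof. by rewrite invr_gt0 !mulr_gt0. Qed.
Lemma delta_const_gt0 : 0 < delta_const.
Proof.
rewrite lt_min; apply/andP; split; last by rewrite invr_gt0 mulr_gt0 ?exprn_gt0.
by rewrite divr_gt0// mulr_gt0 ?eps_const_gt0 ?exprn_gt0.
Qed.
Lemma hardy_const_gt0 : 0 < hardy_const.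
Proof.
have h : 0 <= a ^+ 2 * pi ^+ 2 by rewrite mulr_ge0 ?sqr_ge0.
rewrite lt_min; apply/andP; split.
  by rewrite divr_gt0 ?eps_const_gt0// mulr_gt0 ?exprn_gt0.
rewrite divr_gt0 ?delta_const_gt0//; lra.
Qed.

(** The Hardy weight in the rotated coordinates. *)
Definition log_weight (p : R * R) : R :=
  S p ^+ 3 / (1 + rho p ^+ 2 * ln (ratio p) ^+ 2).

(** The pointwise differential inequality behind the theorem: the excesses of the
    two components add up to at least a multiple of the Hardy weight. *)
Lemma gain_bound p : 0 < p.1 -> 0 < S p < pi ->
  hardy_const * log_weight p <=
  ((sin (S p) ^+ 2)^-1 + eps_const * pos_cube (depth co si p) *
    ((sin (S p) ^+ 2)^-1 + 2 * (pi - S p) * cos (S p) / sin (S p) ^+ 3)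
   - field_s co si eps_const p ^+ 2 - 1) +
  ((2 * rho p ^+ 2)^-1 + delta_const * S p ^+ 3 *
    (1 - (2 * ratio p ^+ 2)^-1 + log_profile (ratio p)) /
    (log_profile (ratio p) * rho p) ^+ 2
   - field_t co si delta_const p ^+ 2 - (4 * rho p ^+ 2)^-1).
Proof.
move=> p1 /andP[s0 spi].
have r0 : 0 < rho p by rewrite rho_coordE// divr_gt0.
have y0 : 0 < ratio p by rewrite /log_ratio divr_gt0// mulr_gt0.
have m1 := log_profile_ge1 y0.
have m0 : 0 < log_profile (ratio p) by lra.
have x0 : 0 < sin (S p) by apply: sin_gt0_pi; rewrite s0.
have rE : rho p = a * S p * ratio p / 2.
  by rewrite /log_ratio; field; rewrite !lt0r_neq0.
have e0 := eps_const_gt0; have d0 := delta_const_gt0.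
have dle1 : delta_const <= eps_const * a ^+ 2 / (64 * 64) by rewrite ge_min lexx.
have dle2 : delta_const <= (4 * pi ^+ 3)^-1 by rewrite ge_min lexx orbT.
have s3 : S p ^+ 3 <= pi ^+ 3 by rewrite lerXn2r// ?nnegrE ltW.
have s30 : 0 < S p ^+ 3 by rewrite exprn_gt0.
have ds : delta_const * S p ^+ 3 <= 1 / 4.
  apply: (@le_trans _ _ ((4 * pi ^+ 3)^-1 * pi ^+ 3)); first by apply: ler_pM => //; exact: ltW.
  rewrite le_eqVlt; apply/orP; left; apply/eqP.
  by move: (pi : R) (lt0r_neq0 pi0) => P PN; field.
rewrite /field_t longitudinal_gain//.
have depth_lt : depth co si p < S p.
  rewrite /depth; have := r0; rewrite /rho_coord -(@ltr_pM2r _ a^-1) ?invr_gt0// mul0r mulrDl.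
  by rewrite mulrC [_ * a^-1]mulrC mulKf ?lt0r_neq0//; lra.
have T0 : 0 <= pos_cube (depth co si p).
  by rewrite exprn_ge0// le_max lexx.
have Ts : pos_cube (depth co si p) <= S p ^+ 3.
  by rewrite lerXn2r// ?nnegrE ?le_max ?lexx ?ge_max ?(ltW s0) ?(ltW depth_lt).
set q := pi - S p; have q0 : 0 < q by rewrite subr_gt0.
have par : S p * q / 32 <= sin (S p) by apply: sin_ge_parabola; rewrite s0.
have Aq : eps_const * pos_cube (depth co si p) * q ^+ 2 <= sin (S p) ^+ 2 / 2.
  have sq0 : 0 <= S p * q by apply: mulr_ge0; exact: ltW.
  have par2 : (S p * q / 32) ^+ 2 <= sin (S p) ^+ 2.
    by rewrite lerXn2r// nnegrE; lra.
  have s3pi : S p ^+ 3 <= pi * S p ^+ 2 by rewrite exprS ler_wpM2r ?sqr_ge0// ltW.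
  apply: (@le_trans _ _ (eps_const * (pi * S p ^+ 2) * q ^+ 2)).
    by rewrite ler_wpM2r ?sqr_ge0// ler_pM2l//; exact: le_trans Ts _.
  have -> : eps_const * (pi * S p ^+ 2) * q ^+ 2 = (S p * q / 32) ^+ 2 / 2.
    by rewrite /eps_const; clearbody q; move: (S p) (pi : R) (lt0r_neq0 pi0) => s P PN; field.
  lra.
have A0 : 0 <= eps_const * pos_cube (depth co si p) by rewrite mulr_ge0// ltW.
have gs := transverse_gain x0 (cos2Dsin2 _) A0 Aq.
rewrite /field_s -/q.
set Es := (X in _ <= X + _).
have {gs} gs : eps_const * pos_cube (depth co si p) / (2 * sin (S p) ^+ 2) <= Es by exact: gs.
have W0 : 0 <= log_weight p.
  by rewrite divr_ge0 ?ltW// ltr_pwDl// mulr_ge0 ?sqr_ge0.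
have Ws3 : log_weight p <= S p ^+ 3.
  rewrite ler_pdivrMr; last by rewrite ltr_pwDl// mulr_ge0 ?sqr_ge0.
  by rewrite -[leLHS]mulr1 ler_pM2l// lerDl mulr_ge0 ?sqr_ge0.
(* along the strip the longitudinal excess suffices; close to the edge [ratio < 1]
   forces [depth] to exceed [s / 2], and the transverse excess is of order [s] *)
have [y1|y1] := leP 1 (ratio p).
  have := far_gain a0 s0 spi r0 y1 rE d0 ds; rewrite -/(log_weight p) => h.
  have h' : hardy_const * log_weight p <=
    delta_const / (4 * (4 * a ^+ 2 * pi ^+ 2 + 18)) * log_weight p.
    by rewrite ler_wpM2r// ge_min lexx orbT.
  have Es0 : 0 <= Es by apply: le_trans gs; rewrite divr_ge0// mulr_ge0// sqr_ge0.
  by rewrite -[leLHS]add0r lerD// (le_trans h').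
have := near_loss a0 s0 y0 rE d0 ds => loss.
have depth_gt : S p / 2 <= depth co si p.
  have : rho p <= a * S p / 2.
    rewrite rE; have : a * S p * ratio p <= a * S p * 1 by apply: ler_wpM2l; [apply/ltW/mulr_gt0|exact: ltW].
    lra.
  rewrite /depth /rho_coord -(@ler_pM2r _ a^-1) ?invr_gt0// mulrDl.
  rewrite [a * S p * a^-1]mulrC mulKf ?lt0r_neq0//.
  have -> : a * S p / 2 / a = S p / 2 by field; rewrite lt0r_neq0.
  lra.
have T8 : (S p / 2) ^+ 3 <= pos_cube (depth co si p).
  by rewrite lerXn2r// ?nnegrE ?le_max ?depth_gt ?orbT// ?lexx// divr_ge0// ltW.
have sinle : sin (S p) ^+ 2 <= S p ^+ 2.
  by have sle := sin_le_id (ltW s0); rewrite lerXn2r// ?nnegrE; apply/ltW.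
have gain : eps_const * S p / 16 <= Es.
  apply: le_trans gs.
  apply: (@le_trans _ _ (eps_const * (S p / 2) ^+ 3 / (2 * S p ^+ 2))).
    by rewrite le_eqVlt; apply/orP; left; apply/eqP; field; rewrite lt0r_neq0.
  apply: ler_pM.
  - by rewrite mulr_ge0 ?exprn_ge0 ?divr_ge0// ltW.
  - by rewrite invr_ge0 mulr_ge0 ?sqr_ge0.
  - by rewrite ler_pM2l.
  - by rewrite lef_pV2 ?posrE ?mulr_gt0 ?exprn_gt0// ler_pM2l.
have lossle : 128 * delta_const * S p / a ^+ 2 <= eps_const * S p / 32.
  have -> : 128 * delta_const * S p / a ^+ 2 = delta_const * (128 * S p / a ^+ 2).
    by field; rewrite lt0r_neq0.
  have -> : eps_const * S p / 32 = eps_const * a ^+ 2 / (64 * 64) * (128 * S p / a ^+ 2).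
    by field; rewrite lt0r_neq0.
  by rewrite ler_pM2r// divr_gt0 ?exprn_gt0// mulr_gt0.
have hw : hardy_const * log_weight p <= eps_const * S p / 32.
  apply: (@le_trans _ _ (eps_const / (32 * pi ^+ 2) * S p ^+ 3)).
    by apply: ler_pM; rewrite ?(ltW hardy_const_gt0)// ge_min lexx.
  have -> : eps_const * S p / 32 = eps_const / (32 * pi ^+ 2) * (S p * pi ^+ 2).
    by move: eps_const (S p) (pi : R) (lt0r_neq0 pi0) => e s P PN; field.
  rewrite ler_pM2l ?divr_gt0 ?mulr_gt0 ?exprn_gt0// exprS ler_pM2l//.
  by rewrite lerXn2r// ?nnegrE ltW.
lra.
Qed.

End GainBound.

(** * The domain and the Hardy inequality on it *)

Section Guide.
Context {R : realType}.
Variable theta : R.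
Hypotheses (theta_gt0 : 0 < theta) (theta_lt : theta < pi / 2).

Local Notation co := (cos theta).
Local Notation si := (sin theta).
Local Notation S := (rot_s co si).

Lemma cos_theta_gt0 : 0 < co.
Proof.
by apply: cos_gt0_pihalf; rewrite theta_lt (lt_trans _ theta_gt0)// oppr_lt0 divr_gt0// pi_gt0.
Qed.

Lemma sin_theta_gt0 : 0 < si.
Proof. by apply: sin_gt0_pihalf; rewrite theta_gt0. Qed.

Let co0 := cos_theta_gt0.
Let si0 := sin_theta_gt0.

Lemma Gui_strip p : Gui theta p -> 0 < p.1 /\ 0 < S p < pi.
Proof.
move=> [p1 _ pmax plt]; split => //.
have := pmax; rewrite gt_max => /andP[_]; rewrite /tan mulrA ltr_pdivrMr// => h1.
have := plt; rewrite /tan mulrA -mulrDl ltr_pdivlMr// => h2.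
rewrite /rot_s; lra.
Qed.

Lemma hardy_weightE : hardy_weight theta =1 log_weight co si.
Proof.
move=> p; rewrite /hardy_weight /log_weight -/(S p).
rewrite /log_ratio !(rho_coordE si0 (cos2Dsin2 theta)) /slope.
have -> : (p.1 / si) ^+ 2 = p.1 ^+ 2 / si ^+ 2 by rewrite exprMn exprVn.
have -> // : p.1 / co * (2 / S p) = 2 * (p.1 / si) / (co / si * S p).
rewrite [(_ * S p)^-1]invfM [(co / si)^-1]invfM invrK; move: (S p)^-1 => z.
by field; rewrite !lt0r_neq0.
Qed.

(** The potential at critical flux is the sharp Hardy potential in [rho]. *)
Lemma potentialE p : 0 < p.1 ->
  (omega_cr theta ^+ 2 - 1 / 4) / p.1 ^+ 2 = - (4 * rho_coord co si p ^+ 2)^-1.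
Proof.
move=> p1; rewrite (rho_coordE si0 (cos2Dsin2 theta)) /omega_cr.
have c2 : co ^+ 2 = 1 - si ^+ 2 by rewrite -(cos2Dsin2 theta); ring.
rewrite exprMn c2; field.
by rewrite !lt0r_neq0.
Qed.

Let continuous_S : continuous S.
Proof.
move=> p; apply: cvgB; apply: cvgM.
- exact: cvg_fst.
- exact: cvg_cst.
- exact: cvg_snd.
- exact: cvg_cst.
Qed.

Lemma continuous_hardy_weight p : Gui theta p ->
  {for p, continuous (hardy_weight theta)}.
Proof.
move=> Gp; have [p1 /andP[s0 _]] := Gui_strip Gp.
have cp : {for p, continuous (fst : R * R -> R)} by exact: cvg_fst.
have cS3 : {for p, continuous (fun q => S q ^+ 3)}.
  by apply: (@continuous_comp _ _ _ S (fun x => x ^+ 3)); [exact: continuous_S|exact: exprn_continuous].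
have ca : {for p, continuous (fun q : R * R => q.1 / co * (2 / S q))}.
  apply: cvgM; apply: cvgM; [exact: cp|exact: cvg_cst|exact: cvg_cst|].
  by apply: cvgV; [exact: lt0r_neq0|exact: continuous_S].
have cl : {for p, continuous (fun q : R * R => ln (q.1 / co * (2 / S q)))}.
  apply: (@continuous_comp _ _ _ _ (@ln R)) => //.
  by apply: continuous_ln; rewrite mulr_gt0// divr_gt0.
rewrite /hardy_weight; apply: cvgM; first exact: cS3.
apply: cvgV.
  by rewrite lt0r_neq0// ltr_pwDl// mulr_ge0 ?divr_ge0 ?sqr_ge0.
apply: cvgD; first exact: cvg_cst.
apply: cvgM; last exact: (continuous_sqr cl).
by apply: cvgM; [exact: (continuous_sqr cp)|exact: cvg_cst].
Qed.

Lemma continuous_potential p : Gui theta p ->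
  {for p, continuous (fun q : R * R => (omega_cr theta ^+ 2 - 1 / 4) / q.1 ^+ 2)}.
Proof.
move=> Gp; have [p1 _] := Gui_strip Gp.
have cp : {for p, continuous (fst : R * R -> R)} by exact: cvg_fst.
apply: cvgM; first exact: cvg_cst.
by apply: cvgV; [rewrite lt0r_neq0// exprn_gt0|exact: (continuous_sqr cp)].
Qed.

Lemma normc_sqr (z : R[i]) : Normc.normc z ^+ 2 = complex.Re z ^+ 2 + complex.Im z ^+ 2.
Proof. by case: z => x y /=; rewrite sqr_sqrtr// addr_ge0 ?sqr_ge0. Qed.

(** The inequality for one real component of the test function. *)
Lemma real_hardy (K : set (R * R)) (w : R * R -> R) : compact K -> K `<=` Gui theta ->
  C1_off K w ->
  (\int[@lebesgue2 R]_p ((1 + hardy_const co si * hardy_weight theta p) * w p ^+ 2) <=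
   \int[@lebesgue2 R]_p energy w (fun q => (omega_cr theta ^+ 2 - 1 / 4) / q.1 ^+ 2) p)%R.
Proof.
move=> cK KG w1.
have cs := cos2Dsin2 theta.
have [ss [st [Cs ssE]]] := field_s_C1 co0 si0 Gui_strip (@eps_const R).
have [ts [tt [Ct ttE]]] := field_t_C1 co0 si0 cs Gui_strip (delta_const co si).
pose Fs := field_s co si (@eps_const R); pose Ft := field_t co si (delta_const co si).
have ccst k := @C1_cst _ co si (Gui theta) k.
have C1F1 := C1_D (C1_M (ccst co) Cs) (C1_M (ccst si) Ct).
have C1F2 := C1_D (C1_M (ccst (- si)) Cs) (C1_M (ccst co) Ct).
have cfs p (Gp : Gui theta p) : {for p, continuous ss} by case: (Cs p Gp).
have cft p (Gp : Gui theta p) : {for p, continuous st} by case: (Cs p Gp).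
have cgs p (Gp : Gui theta p) : {for p, continuous ts} by case: (Ct p Gp).
have cgt p (Gp : Gui theta p) : {for p, continuous tt} by case: (Ct p Gp).
have clin (k l : R) (f g : R * R -> R) p : {for p, continuous f} -> {for p, continuous g} ->
    {for p, continuous (fun q => k * f q + l * g q)}.
  by move=> cf cg; apply: cvgD; apply: cvgM => //; exact: cvg_cst.
(* components of the field along the original axes *)
apply: (@vector_field_barrier _ (Gui theta) K cK KG w
  (fun p => co * Fs p + si * Ft p) (fun p => - si * Fs p + co * Ft p)
  (fun p => co * (co * ss p + si * ts p) + si * (co * st p + si * tt p))
  (fun p => - si * (- si * ss p + co * ts p) + co * (- si * st p + co * tt p))) => //.
- by move=> p Gp; exact: (C1_continuous C1F1 Gp).
- by move=> p Gp; exact: (C1_continuous C1F2 Gp).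
- by move=> p Gp; apply: (@clin); apply: (@clin); auto.
- by move=> p Gp; apply: (@clin); apply: (@clin); auto.
- exact: continuous_potential.
- move=> p Gp; apply: cvgD; first exact: cvg_cst.
  by apply: cvgM; [exact: cvg_cst|exact: continuous_hardy_weight].
- move=> p Gp; apply: (is_derive_eq (C1_is_derive (1, 0) C1F1 Gp)).
  by rewrite /rot_s /rot_t /=; ring.
- move=> p Gp; apply: (is_derive_eq (C1_is_derive (0, 1) C1F2 Gp)).
  by rewrite /rot_s /rot_t /=; ring.
- move=> p Gp; have [p1 sp] := Gui_strip Gp.
  rewrite hardy_weightE potentialE//.
  have := gain_bound co0 si0 cs p1 sp; rewrite -ssE// -ttE// -/(Fs p) -/(Ft p) => h.
  have -> : co * (co * ss p + si * ts p) + si * (co * st p + si * tt p) +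
    (- si * (- si * ss p + co * ts p) + co * (- si * st p + co * tt p)) -
    (co * Fs p + si * Ft p) ^+ 2 - (- si * Fs p + co * Ft p) ^+ 2 =
    (co ^+ 2 + si ^+ 2) * (ss p + tt p - Fs p ^+ 2 - Ft p ^+ 2) by ring.
  rewrite cs mul1r; lra.
Qed.

End Guide.

Theorem theorem1p6 (R : realType) (theta : R)
    (theta_gt0 : 0 < theta) (theta_lt : theta < pi / 2) :
  exists2 c : R, 0 < c &
    forall u : R * R -> R[i], test_function (Gui theta) u ->
      (c%:E * \int[@lebesgue2 R]_(p in Gui theta)
                (hardy_weight theta p * Normc.normc (u p) ^+ 2)%:E
       <= q_form theta u - sqL2norm (Gui theta) u)%E.
Proof.
have co0 := cos_theta_gt0 theta_gt0 theta_lt.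
have si0 := sin_theta_gt0 theta_gt0 theta_lt.
exists (hardy_const (cos theta) (sin theta)); first exact: hardy_const_gt0.
move=> u [sre sim cK KG].
set c := hardy_const _ _; set K := closure _ in cK KG.
have u0 p : ~ K p -> u p = 0.
  by move=> nK; apply/eqP/negPn/negP => up; apply: nK; exact: subset_closure.
have w1 : C1_off K (re_fun u) by split; [exact: sre|move=> p /u0; rewrite /re_fun => ->].
have w2 : C1_off K (im_fun u) by split; [exact: sim|move=> p /u0; rewrite /im_fun => ->].
have h1 := real_hardy theta_gt0 theta_lt cK KG w1.
have h2 := real_hardy theta_gt0 theta_lt cK KG w2.
set V := (fun q : R * R => (omega_cr theta ^+ 2 - 1 / 4) / q.1 ^+ 2) in h1 h2.
set h := hardy_weight theta in h1 h2 *.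
pose m p := re_fun u p ^+ 2 + im_fun u p ^+ 2.
have mE p : Normc.normc (u p) ^+ 2 = m p by rewrite normc_sqr.
have re0 p : ~ K p -> re_fun u p = 0 by case: w1 => _; exact.
have im0 p : ~ K p -> im_fun u p = 0 by case: w2 => _; exact.
have cre : continuous (re_fun u) by case: w1 => -[].
have cim : continuous (im_fun u) by case: w2 => -[].
have ch p : Gui theta p -> {for p, continuous h}.
  exact: continuous_hardy_weight.
have cV p : Gui theta p -> {for p, continuous V} by exact: continuous_potential.
have m0 p : ~ K p -> m p = 0 by move=> nK; rewrite /m re0// im0// expr0n/= addr0.
have cm p : Gui theta p -> {for p, continuous m}.
  by move=> _; apply: cvgD; apply: continuous_sqr; [exact: cre|exact: cim].
have hm0 p : ~ K p -> h p * m p = 0 by move=> /m0 ->; rewrite mulr0.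
have chm p : Gui theta p -> {for p, continuous (fun q => h q * m q)}.
  by move=> Gp; apply: cvgM; [exact: ch|exact: cm].
have e1 := energy_continuous w1 cV; have e2 := energy_continuous w2 cV.
have e10 := energy_off cK V w1; have e20 := energy_off cK V w2.
pose Q p := energy (re_fun u) V p + energy (im_fun u) V p.
have QE p : Normc.normc (cd_r u p) ^+ 2 + Normc.normc (cd_z u p) ^+ 2 +
    (omega_cr theta ^+ 2 - 1 / 4) / p.1 ^+ 2 * Normc.normc (u p) ^+ 2 = Q p.
  rewrite [X in X + _ + _]normc_sqr [X in _ + X + _]normc_sqr [X in _ * X]mE.
  by rewrite [X in _ + X]mulrDr [X in X + _]addrACA; exact: addrACA.
have cQ p : Gui theta p -> {for p, continuous Q}.
  by move=> Gp; apply: cvgD; [exact: e1|exact: e2].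
have Q0 p : ~ K p -> Q p = 0 by move=> nK; rewrite /Q e10// e20// addr0.
pose W p := 1 + c * h p.
have cW p : Gui theta p -> {for p, continuous W}.
  move=> Gp; apply: cvgD; first exact: cvg_cst.
  by apply: cvgM; [exact: cvg_cst|exact: ch].
have iW1 := integrable_off cK KG (weighted_sqr_continuous w1 cW) (weighted_sqr_off W w1).
have iW2 := integrable_off cK KG (weighted_sqr_continuous w2 cW) (weighted_sqr_off W w2).
have iE1 := integrable_off cK KG e1 e10; have iE2 := integrable_off cK KG e2 e20.
have im := integrable_off cK KG cm m0; have ihm := integrable_off cK KG chm hm0.
have ichm : (@lebesgue2 R).-integrable setT (EFin \o (fun p => c * (h p * m p))).
  exact: (integrableZl measurableT c ihm).
rewrite /q_form /sqL2norm.
under eq_integral do rewrite mE.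
under [X in (_ <= X - _)%E]eq_integral do rewrite QE.
under [X in (_ <= _ - X)%E]eq_integral do rewrite mE.
rewrite (integral_off cK KG chm hm0) (integral_off cK KG cQ Q0).
rewrite (integral_off cK KG cm m0) -EFinM -EFinB lee_fin lerBrDl.
have -> : (\int[@lebesgue2 R]_p Q p = \int[@lebesgue2 R]_p energy (re_fun u) V p +
    \int[@lebesgue2 R]_p energy (im_fun u) V p)%R.
  exact: (RintegralD measurableT iE1 iE2).
apply: le_trans (lerD h1 h2).
rewrite le_eqVlt; apply/orP; left; apply/eqP.
transitivity (\int[@lebesgue2 R]_p (m p + c * (h p * m p)))%R.
  rewrite (RintegralD measurableT im ichm).
  congr (_ + _); symmetry; exact: (RintegralZl c measurableT ihm).
rewrite -[RHS](RintegralD measurableT iW1 iW2).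
by apply: eq_Rintegral => p _; rewrite /= /W /m; move: (h p) => k; ring.
Qed.
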